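(* ${\mathbb{G}}_2\neq B_2$, where ${\mathbb{G}}_2=\bar{\mathbb{B}}_2\circ S_{\Delta_2}$.
   Context: All operators act on $C[0,1]$, the real-valued continuous functions on $[0,1]$. The Bernstein operator is $B_n(f;x)=\sum_{k=0}^n f(k/n)\binom nk x^k(1-x)^{n-k}$. $S_{\Delta_n}:C[0,1]\to C[0,1]$ is piecewise linear interpolation at the points $0,\frac1n,\dots,\frac{n-1}{n},1$. The genuine Beta operator $\bar{\mathbb{B}}_n:C[0,1]\to C[0,1]$ is defined by $\bar{\mathbb{B}}_n(f;0)=f(0)$, $\bar{\mathbb{B}}_n(f;1)=f(1)$, and for $x\in(0,1)$ $$\bar{\mathbb{B}}_n(f;x)=\frac{1}{B(nx,n(1-x))}\int_0^1 t^{nx-1}(1-t)^{n(1-x)-1}f(t)\,dt,$$ where $B(\cdot,\cdot)$ is the Euler Beta function. ${\mathbb{G}}_n:=\bar{\mathbb{B}}_n\circ S_{\Delta_n}$. *)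

(* Defs.v *)
From HB Require Import structures.
From mathcomp Require Import all_boot all_order all_algebra.
From mathcomp Require Import all_classical all_reals all_analysis.

Set Implicit Arguments.
Unset Strict Implicit.
Unset Printing Implicit Defensive.

Import Order.TTheory GRing.Theory Num.Theory.
Import numFieldTopology.Exports numFieldNormedType.Exports.

Local Open Scope classical_set_scope.
Local Open Scope ring_scope.

(* An element of C[0,1] is represented by a function f : R -> R such that
   {within `[0, 1], continuous f}; its values outside [0,1] carry no meaning
   and none of the operators below reads them when evaluated at a point of
   [0,1]. *)

(* Equality of two operators on C[0,1]: equal values on every element of
   C[0,1] at every point of [0,1]. *)
Definition eq_operator_C01 (R : realType) (T U : (R -> R) -> (R -> R)) : Prop :=
  forall f : R -> R, {within `[0, 1], continuous f} ->
  forall x : R, x \in `[0, 1]%R -> T f x = U f x.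

Definition bernstein (R : realType) (n : nat) (f : R -> R) (x : R) : R :=
  \sum_(k < n.+1) f (k%:R / n%:R) * 'C(n, k)%:R * x ^+ k * (1 - x) ^+ (n - k).

(* Piecewise linear interpolation at the nodes 0, 1/n, ..., 1, for n > 0.
   For x in [0,1], k is the index of a cell [k/n, (k+1)/n] containing x; the
   minimum places x = 1 in the last cell. See interp_linearE. *)
Definition interp_linear (R : realType) (n : nat) (f : R -> R) (x : R) : R :=
  let k := minn (Num.truncn (n%:R * x)) n.-1 in
  line_path (f (k%:R / n%:R)) (f (k.+1%:R / n%:R)) (n%:R * x - k%:R).

Lemma interp_linearE (R : realType) (n k : nat) (f : R -> R) (x : R) :
  (k < n)%N -> k%:R / n%:R <= x <= k.+1%:R / n%:R ->
  interp_linear n f x =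
    line_path (f (k%:R / n%:R)) (f (k.+1%:R / n%:R)) (n%:R * x - k%:R).
Proof.
move=> kn; have n0 : 0 < n%:R :> R by rewrite ltr0n (leq_ltn_trans _ kn).
rewrite ler_pdivrMr// ler_pdivlMr// ![x * _]mulrC => /andP[kx xk].
rewrite /interp_linear; move: xk; rewrite le_eqVlt => /predU1P[xk|xk].
- rewrite xk natrK.
  have [kn1|kn1] := ltnP k.+1 n.
    have -> : minn k.+1 n.-1 = k.+1.
      by apply/minn_idPl; rewrite -ltnS prednK// (leq_ltn_trans _ kn).
    have -> : k.+1%:R - k%:R = 1 :> R by rewrite -natr1 addrAC subrr add0r.
    by rewrite /line_path !subrr subr0 !mul0r !mul1r addr0 add0r.
  have -> // : minn k.+1 n.-1 = k.
  have -> : n = k.+1 by apply/eqP; rewrite eqn_leq kn1 kn.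
  by apply/minn_idPr.
- have -> : Num.truncn (n%:R * x) = k by apply/truncn_def; rewrite kx xk.
  have -> // : minn k n.-1 = k.
  by apply/minn_idPl; rewrite -ltnS prednK// (leq_ltn_trans _ kn).
Qed.

(* Integrals over ]0,1[ are Lebesgue integrals, so no separate treatment of the
   endpoint singularities is needed. The library's beta_fun only has natural
   number parameters. *)
Definition Euler_beta (R : realType) (a b : R) : R :=
  \int[lebesgue_measure]_(t in `]0, 1[) (t `^ (a - 1) * (1 - t) `^ (b - 1)).

Definition genuine_beta (R : realType) (n : nat) (f : R -> R) (x : R) : R :=
  if x == 0 then f 0
  else if x == 1 then f 1
  else (Euler_beta (n%:R * x) (n%:R * (1 - x)))^-1 *
    \int[lebesgue_measure]_(t in `]0, 1[)
      (t `^ (n%:R * x - 1) * (1 - t) `^ (n%:R * (1 - x) - 1) * f t).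

Definition G_operator (R : realType) (n : nat) : (R -> R) -> (R -> R) :=
  @genuine_beta R n \o @interp_linear R n.

(* Main.v *)
(* Take f in C[0,1] with f(0) = f(1/2) = 0 and f(1) = 1. Then B_2 f (x) = x^2 is
   quadratic near 0, while G_2 f (x) is of order x: B(2x, 2-2x) <= 1/(2x), and
   the integral of t^(2x-1) (1-t)^(1-2x) max(0, 2t-1) stays above 1/128 because
   its integrand is at least 1/16 on [3/4, 7/8]. At x = 1/128 this gives
   G_2 f (x) >= 2^-13 > 2^-14 = B_2 f (x). *)

Require Import Defs.
From HB Require Import structures.
From mathcomp Require Import all_boot all_order all_algebra.
From mathcomp Require Import all_classical all_reals all_analysis.
From mathcomp Require Import measurable_realfun ring lra.

Set Implicit Arguments.
Unset Strict Implicit.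
Unset Printing Implicit Defensive.

Import Order.TTheory GRing.Theory Num.Theory.
Import numFieldTopology.Exports numFieldNormedType.Exports.

Local Open Scope classical_set_scope.
Local Open Scope ring_scope.

(** An antiderivative is [a^-1 * t ^ a]. Starting at [e > 0] keeps the possible singularity at 0
    outside the interval, so the fundamental theorem of calculus applies. *)
Lemma integral_powR_itvcc (R : realType) (a e : R) : 0 < a -> 0 < e < 1 ->
  (\int[lebesgue_measure]_(t in `[e, 1%R]) (t `^ (a - 1))%:E
    = (a^-1 * (1 - e `^ a))%:E)%E.
Proof.
move=> a0 /andP[e0 e1].
have powR_derivable p :
    {in `[e, 1]%R, forall x : R, derivable (@powR R ^~ p) x 1}.
  move=> x; rewrite in_itv/= => /andP[ex _].
  by apply: derivable_powR; rewrite in_itv/= andbT (lt_le_trans e0).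
have F_within : {within `[e, 1], continuous (fun x : R => a^-1 * x `^ a)}.
  apply: derivable_within_continuous => x xe.
  by apply: derivableM => //; exact: powR_derivable.
rewrite (@continuous_FTC2 _ _ (fun x => a^-1 * x `^ a)) //.
- by rewrite powR1 mulrBr EFinB.
- exact: derivable_within_continuous.
- have [F1 F2 F3] := (continuous_within_itvP _ e1).1 F_within.
  split => // x xe.
  by apply: derivableM => //; apply: powR_derivable; exact: subset_itv_oo_cc xe.
- move=> x; rewrite in_itv/= => /andP[ex _].
  have x0 : 0 < x by exact: lt_trans ex.
  rewrite derive1E deriveM //; last first.
    by apply: derivable_powR; rewrite in_itv/= andbT.
  rewrite derive_cst scaler0 addr0 -derive1E powR_derive1 ?in_itv/= ?andbT //.
  by rewrite /GRing.scale/= mulrA mulVf ?mul1r // gt_eqF.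
Qed.

(** Monotone convergence along the intervals from [1/(n+1)] to 1, which exhaust []0, 1]]: each
    truncated integral has the closed form above, hence is at most [a^-1]. *)
Lemma le_integral_powR (R : realType) (a : R) : 0 < a ->
  (\int[lebesgue_measure]_(t in `]0%R, 1%R]) (t `^ (a - 1))%:E <= (a^-1)%:E)%E.
Proof.
move=> a0; rewrite itv_open_bnd_bigcup.
have inv_gt0 n : 0 < n.+1%:R^-1 :> R by rewrite invr_gt0.
apply: (@cvge_le _ \oo); last first.
  apply: ge0_nondecreasing_set_cvg_integral => //.
  - apply/nondecreasing_seqP => n; rewrite subsetEset; apply: subset_itvr.
    by rewrite bnd_simp !add0r lef_pV2 ?posrE // ler_nat.
  - move=> n; apply/measurable_EFinP; apply: measurable_funTS.
    exact: measurable_powR.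
  - by move=> n x _; rewrite lee_fin powR_ge0.
(* For [n = 0] the interval shrinks to the point 1, while the closed form asks for [e < 1]; hence
   only large [n] are considered. *)
near=> n.
rewrite add0r integral_powR_itvcc //.
  by rewrite lee_fin ler_piMr ?invr_ge0 ?(ltW a0) // gerBl powR_ge0.
rewrite inv_gt0 /= invf_lt1 // ltr1n ltnS.
by near: n; exact: nbhs_infty_gt.
Unshelve. all: by end_near. Qed.

Lemma measurable_beta_weight (R : realType) (p q : R) (D : set R) :
  measurable_fun D (fun t : R => t `^ p * (1 - t) `^ q).
Proof.
apply: measurable_funTS; apply: measurable_funM; first exact: measurable_powR.
apply: (measurableT_comp (measurable_powR q)).
exact: measurable_funB.
Qed.

Lemma le_integral_beta (R : realType) (a b : R) : 0 < a -> 1 <= b ->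
  (\int[lebesgue_measure]_(t in `]0%R, 1%R[)
     (t `^ (a - 1) * (1 - t) `^ (b - 1))%:E <= (a^-1)%:E)%E.
Proof.
move=> a0 b1; apply: le_trans (le_integral_powR a0).
have weight_ge0 (t : R) : 0 <= t `^ (a - 1) * (1 - t) `^ (b - 1).
  by rewrite mulr_ge0 ?powR_ge0.
have mpow (D : set R) : measurable_fun D (fun t : R => (t `^ (a - 1))%:E).
  by apply/measurable_EFinP; apply: measurable_funTS; exact: measurable_powR.
(* Removing the null point 1 makes both domains equal and ensures [0 < 1 - t], as the comparison of
   exponents requires. *)
rewrite -integral_itv_bndo_bndc //.
apply: ge0_le_integral => //.
- by move=> t _; rewrite lee_fin.
- by apply/measurable_EFinP; exact: measurable_beta_weight.
- exact: mpow.
- move=> t /=; rewrite in_itv/= => /andP[t0 t1].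
  rewrite lee_fin ler_piMr ?powR_ge0 //.
  rewrite -[leRHS](powRr0 (1 - t)) ger_powR ?subr_ge0 //.
  by rewrite subr_gt0 t1 gerBl ltW.
Qed.

Lemma le_integral_itvcc (R : realType) (a b c : R) (D : set R) (g : R -> R) :
  measurable D -> measurable_fun D g -> (forall t, D t -> 0 <= g t) ->
  a < b -> `[a, b] `<=` D -> 0 <= c -> (forall t, a <= t <= b -> c <= g t) ->
  ((c * (b - a))%:E <= \int[lebesgue_measure]_(t in D) (g t)%:E)%E.
Proof.
move=> mD mg g0 ab abD c0 cg.
apply: (@le_trans _ _ (\int[lebesgue_measure]_(t in `[a, b]) (g t)%:E)%E);
    last first.
  apply: ge0_subset_integral => //; exact/measurable_EFinP.
apply: (@le_trans _ _ (\int[lebesgue_measure]_(t in `[a, b]) (cst c%:E t))%E).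
  by rewrite integral_cst //= lebesgue_measure_itv /= lte_fin ab -EFinB -EFinM.
apply: ge0_le_integral => //.
by apply/measurable_EFinP; exact: measurable_funS mg.
Qed.

(* The test function u (2u - 1) matters only through its values 0, 0, 1 at the
   nodes 0, 1/2, 1. *)
Lemma interp_linear2_quadratic (R : realType) (t : R) : 0 <= t <= 1 ->
  interp_linear 2 (fun u => u * (2 * u - 1)) t = Num.max 0 (2 * t - 1).
Proof.
move=> /andP[t0 t1]; have [th|th] := leP t (2^-1).
  rewrite (@interp_linearE _ 2 0) //; last by rewrite mul0r t0 mul1r.
  by rewrite max_l; [rewrite /line_path; field | lra].
rewrite (@interp_linearE _ 2 1) //; last by rewrite mul1r divff // t1 (ltW th).
by rewrite max_r; [rewrite /line_path; field | lra].
Qed.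

Lemma bernstein2_quadratic (R : realType) (x : R) :
  bernstein 2 (fun u => u * (2 * u - 1)) x = x ^+ 2.
Proof.
rewrite /bernstein !big_ord_recr big_ord0 /= binn bin0 bin1 subnn expr0.
by field.
Qed.

Theorem mainTheorem3 (R : realType) :
  ~ eq_operator_C01 (@G_operator R 2) (@bernstein R 2).
Proof.
pose f (u : R) := u * (2 * u - 1).
(* With x = 1/128, [s] is 2x and [2 - s] is 2(1 - x), so [w] is the Beta weight before
   normalisation; [h] is the interpolant of [f] on [0,1]. *)
pose s : R := 64^-1; pose w (t : R) := t `^ (s - 1) * (1 - t) `^ (2 - s - 1).
pose h (t : R) := Num.max 0 (2 * t - 1).
have w_ge0 t : 0 <= w t by rewrite /w mulr_ge0 ?powR_ge0.
have h_ge0 t : 0 <= h t by rewrite le_max lexx.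
have mw D : measurable_fun D (EFin \o w).
  by apply/measurable_EFinP; exact: measurable_beta_weight.
have mwh D : measurable_fun D (w \* h).
  apply: measurable_funM; first exact: measurable_beta_weight.
  apply: measurable_maxr; first exact: measurable_cst.
  by apply: measurable_funB => //; exact: measurable_funM.
have beta_le :
    (\int[lebesgue_measure]_(t in `]0%R, 1%R[) (w t)%:E <= 64%:E)%E.
  by apply: (le_trans (le_integral_beta _ _)); rewrite ?invrK // /s; lra.
have integral_le : (\int[lebesgue_measure]_(t in `]0%R, 1%R[) (w t * h t)%:E
    <= \int[lebesgue_measure]_(t in `]0%R, 1%R[) (w t)%:E)%E.
  apply: ge0_le_integral => //.
  - by move=> t _; rewrite lee_fin mulr_ge0.
  - by apply/measurable_EFinP; exact: mwh.
  - exact: mw.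
  - move=> t /=; rewrite in_itv/= => /andP[t0 t1].
    by rewrite lee_fin ler_piMr // ge_max; lra.
have integral_ge : ((128^-1)%:E <=
    \int[lebesgue_measure]_(t in `]0%R, 1%R[) (w t * h t)%:E)%E.
  (* On [3/4, 7/8] the three factors are at least 1 (negative exponent), 1/8 (exponent at most 1, so
     the power dominates [1 - t]) and 1/2. *)
  rewrite (_ : 128^-1 = 16^-1 * (7 / 8 - 3 / 4)); last by field.
  apply: le_integral_itvcc => //.
  - by move=> t _; rewrite mulr_ge0.
  - lra.
  - by move=> t /=; rewrite !in_itv/=; lra.
  - move=> t /andP[t0 t1].
    have t_ge1 : 1 <= t `^ (s - 1).
      by rewrite -[leLHS](powRr0 t) ger_powR // /s; lra.
    have t_ge8 : 8^-1 <= (1 - t) `^ (2 - s - 1).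
      apply: (@le_trans _ _ (1 - t)); first by lra.
      by apply: ger1_powR; rewrite /s; lra.
    have w_ge8 : 8^-1 <= w t.
      by rewrite -[leLHS]mul1r; apply: ler_pM.
    have h_ge2 : 2^-1 <= h t by rewrite le_max; apply/orP; right; lra.
    rewrite (_ : 16^-1 = 8^-1 * 2^-1); last by field.
    by apply: ler_pM.
(* Real integrals are obtained by [fine], which sends infinity to 0; the bounds carry over to them
   only once finiteness is known. *)
have beta_fin : (\int[lebesgue_measure]_(t in `]0%R, 1%R[) (w t)%:E)%E \is a fin_num.
  rewrite ge0_fin_numE; first exact: le_lt_trans beta_le (ltry _).
  by apply: integral_ge0 => t _; rewrite lee_fin.
have integral_fin : (\int[lebesgue_measure]_(t in `]0%R, 1%R[) (w t * h t)%:E)%E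
    \is a fin_num.
  rewrite ge0_fin_numE; last first.
    by apply: integral_ge0 => t _; rewrite lee_fin mulr_ge0.
  exact: le_lt_trans integral_le (le_lt_trans beta_le (ltry _)).
pose B := Euler_beta s (2 - s).
pose I := \int[lebesgue_measure]_(t in `]0, 1[) (w t * h t).
have B_le : B <= 64 by rewrite -lee_fin /B /Euler_beta /Rintegral fineK.
have I_ge : 128^-1 <= I by rewrite -lee_fin /I /Rintegral fineK.
(* Together with [I_ge] this gives [B > 0], so that [B^-1] is a genuine inverse. *)
have IB : I <= B by rewrite /I /B /Euler_beta /Rintegral fine_le.
have f_cont : {within `[0, 1], continuous f}.
  apply: continuous_subspaceT => x; apply: cvgM; first exact: cvg_id.
  by apply: cvgB; [apply: cvgM; [exact: cvg_cst|exact: cvg_id]|exact: cvg_cst].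
move=> /(_ f f_cont (128^-1)).
rewrite in_itv/= => /(_ ltac:(lra)).
rewrite bernstein2_quadratic /G_operator /= /genuine_beta ifF; last by apply/eqP; lra.
rewrite ifF; last by apply/eqP; lra.
rewrite (_ : 2 * 128^-1 = s); last by rewrite /s; field.
rewrite (_ : 2 * (1 - 128^-1) = 2 - s); last by rewrite /s; field.
rewrite -/B (_ : Rintegral _ _ _ = I); last first.
  apply: eq_Rintegral => t; rewrite inE/= in_itv/= => /andP[t0 t1].
  by rewrite interp_linear2_quadratic // !ltW.
move=> GB.
have B_gt0 : 0 < B by lra.
(* This forces I <= 64/2^14 = 2^-8, against I >= 2^-7. *)
have : I = 128^-1 ^+ 2 * B by rewrite -GB mulrAC mulVf ?mul1r // gt_eqF.
by lra.
Qed.
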